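(* Let $N\ge 2$ be an integer and let $t\ge 0$ be fixed. Let $(A,d)$ be an infinite compact metric space with $\operatorname{diam}(A)<1$. For each $s\ge 0$ let $\omega_N^{s,\log^t}$ denote a minimal $N$-point $s,\log^t$-energy configuration on $A$. Then for any $s_0>0$, any cluster configuration of $\omega_N^{s,\log^t}$ as $s\to s_0$ is a minimal $N$-point $s_0,\log^t$-energy configuration on $A$.
   Context: $\operatorname{diam}(A):=\sup_{x,y\in A}d(x,y)$. An $N$-point configuration is a set $\omega_N\subset A$ of $N$ distinct points. For $s,t\ge 0$ define $$E^s_{\log^t}(\omega_N):=\sum_{\substack{x\ne y\\ x,y\in\omega_N}}\frac{1}{d(x,y)^s}\left(\log\frac{1}{d(x,y)}\right)^t$$ (sum over ordered pairs of distinct points; for $t=0$ the logarithmic factor is $1$), and $$\mathcal{E}^s_{\log^t}(A,N):=\min_{\omega_N\subset A,\ \#\omega_N=N}E^s_{\log^t}(\omega_N).$$ The minimum is attained; a minimizer (not necessarily unique) is called a minimal $N$-point $s,\log^t$-energy configuration. An $N$-point configuration $\omega_N\subset A$ is a cluster configuration of $\omega_N^{s,\log^t}$ as $s\to s_0$ if there is a sequence $\{s_k\}_{k=1}^\infty\subset[0,\infty)$ with $s_k\to s_0$ and $\omega_N^{s_k,\log^t}\to\omega_N$ as $k\to\infty$ in the topology of $A^N$ induced by $d$ (configurations being regarded as $N$-tuples of points). *)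

(* Defs.v *)
From HB Require Import structures.
From mathcomp Require Import all_boot all_order all_algebra finmap.
From mathcomp Require Import all_classical all_reals all_analysis.

Set Implicit Arguments.
Unset Strict Implicit.
Unset Printing Implicit Defensive.

Import Order.TTheory GRing.Theory Num.Theory.
Import numFieldNormedType.Exports.

Local Open Scope classical_set_scope.
Local Open Scope ring_scope.

(* Valued in the extended reals, so that no boundedness is presupposed. *)
Definition diam (R : realType) (T : metricType R) (A : set T) : \bar R :=
  ereal_sup [set (mdist p.1 p.2)%:E | p in A `*` A].

Definition configuration (R : realType) (T : metricType R) (N : nat)
    (w : {fset T}) : Prop :=
  #|` w| = N.

(* When t = 0 the logarithmic factor is 1, since a `^ 0 = 1 for every a. When
   the diameter is less than 1, every base raised to a power here is positive,
   so that powR is the usual real power. *)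
Definition energy (R : realType) (T : metricType R) (s t : R)
    (w : {fset T}) : R :=
  \sum_(x <- w) \sum_(y <- w | x != y)
    1 / (mdist x y `^ s) * (ln (1 / mdist x y) `^ t).

Definition minimal_configuration (R : realType) (T : metricType R) (N : nat)
    (s t : R) (w : {fset T}) : Prop :=
  configuration N w /\
  forall w' : {fset T}, configuration N w' -> energy s t w <= energy s t w'.

(* x is w regarded as an N-tuple of points, the order being arbitrary. *)
Definition enumerates (R : realType) (T : metricType R) (N : nat)
    (x : 'I_N -> T) (w : {fset T}) : Prop :=
  injective x /\ w = [fset x i | i : 'I_N]%fset.

(* Configurations are unordered, so their convergence in T^N is convergence,
   in the product topology, of suitable orderings of their points. *)
Definition config_cvg (R : realType) (T : metricType R) (N : nat)
    (w_ : nat -> {fset T}) (w : {fset T}) : Prop :=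
  exists (x_ : nat -> {ptws 'I_N -> T}) (x : {ptws 'I_N -> T}),
    [/\ forall k, enumerates (x_ k) (w_ k), enumerates x w & x_ @ \oo --> x].

Definition cluster_configuration (R : realType) (T : metricType R) (N : nat)
    (W : R -> {fset T}) (s0 : R) (w : {fset T}) : Prop :=
  configuration N w /\
  exists s_ : nat -> R,
    [/\ forall k, 0 <= s_ k, s_ @ \oo --> s0 & config_cvg N (W \o s_) w].

(* Main.v *)
Require Import Defs.
From HB Require Import structures.
From mathcomp Require Import all_boot all_order all_algebra finmap.
From mathcomp Require Import all_classical all_reals all_analysis.
From mathcomp Require Import lra.

Import Order.TTheory GRing.Theory Num.Theory.
Import numFieldNormedType.Exports.

Local Open Scope classical_set_scope.
Local Open Scope ring_scope.

(** The energy of a configuration depends jointly continuously on the exponent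
    and on the points as long as the points stay away from each other: the
    kernel [d^-s (log 1/d)^t] is continuous in [(s, d)] for [0 < d < 1]
    ([log_riesz_kernel_cvg]), and the limit [w] of the minimizers consists, by
    definition of a cluster configuration, of [N] distinct points, whose
    mutual distances lie in that range because the diameter is less than 1.

    Hence, if [s_k --> s0] and the minimizers [omega s_k] tend to [w], then
    [E_{s_k} (omega s_k) --> E_{s0} w], while [E_{s_k} w' --> E_{s0} w'] for
    any fixed competitor [w'].  Both limits are instances of
    [pair_energy_cvg].  The inequalities
    [E_{s_k} (omega s_k) <= E_{s_k} w'] pass to the limit. *)

Definition log_riesz_kernel {R : realType} (s t d : R) : R :=
  1 / (d `^ s) * (ln (1 / d) `^ t).

Lemma powR_cvg (R : realType) (T : Type) (F : set_system T) (FF : Filter F)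
    (f g : T -> R) (a s : R) :
  0 < a -> f @ F --> a -> g @ F --> s -> f x `^ g x @[x --> F] --> a `^ s.
Proof.
move=> a_gt0 fa gs.
have -> : a `^ s = expR (s * ln a) by rewrite /powR gt_eqF.
(* [powR] is defined by cases; near [a > 0] it is an exponential *)
apply: (@cvg_trans _ (expR (g x * ln (f x)) @[x --> F])).
  apply: near_eq_cvg; near=> x.
  rewrite /powR gt_eqF//; near: x; exact: (cvgr_gt _ fa).
apply: (cvg_comp (fun x => g x * ln (f x)) expR); last exact: continuous_expR.
apply: cvgM => //.
by apply: (cvg_comp f (@ln R) fa); exact: continuous_ln.
Unshelve. all: by end_near.
Qed.

Lemma mdist_cvg (R : realType) (A : metricType R) (T : Type)
    (F : set_system T) (FF : Filter F) (u v : T -> A) (a b : A) :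
  u @ F --> a -> v @ F --> b -> mdist (u x) (v x) @[x --> F] --> mdist a b.
Proof.
move=> ua vb; apply/cvgrPdist_lt => e e0.
have e20 : 0 < e / 2 by rewrite divr_gt0.
near=> x.
have da : mdist a (u x) < e / 2.
  by near: x; exact: (metricType_numDomainType.cvgr_dist_lt ua).
have db : mdist b (v x) < e / 2.
  by near: x; exact: (metricType_numDomainType.cvgr_dist_lt vb).
have := metric_triangle a (u x) b; have := metric_triangle (u x) (v x) b.
have := metric_triangle (u x) a (v x); have := metric_triangle a b (v x).
rewrite (metric_sym (u x) a) (metric_sym (v x) b) => h1 h2 h3 h4.
by rewrite ltr_distlC; apply/andP; split; lra.
Unshelve. all: by end_near.
Qed.

(** The bound [d < 1] makes the base of the logarithmic factor positive, where
    real powers are continuous for every exponent, including [t = 0]. *)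
Lemma log_riesz_kernel_cvg (R : realType) (T : Type) (F : set_system T)
    (FF : Filter F) (sigma delta : T -> R) (s t d : R) :
  0 < d < 1 -> sigma @ F --> s -> delta @ F --> d ->
  log_riesz_kernel (sigma x) t (delta x) @[x --> F] --> log_riesz_kernel s t d.
Proof.
move=> /andP[d0 d1] sig del.
have inv_cvg : 1 / delta x @[x --> F] --> 1 / d.
  by apply: cvgM; [exact: cvg_cst | apply: cvgV => //; rewrite gt_eqF].
have log_base_gt0 : 0 < ln (1 / d) by rewrite ln_gt0// div1r invf_gt1.
apply: cvgM.
  apply: cvgM; first exact: cvg_cst.
  apply: cvgV; first by rewrite gt_eqF// powR_gt0.
  exact: powR_cvg.
apply: powR_cvg => //; last exact: cvg_cst.
apply: (cvg_comp _ (@ln R) inv_cvg); apply: continuous_ln.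
by rewrite divr_gt0.
Qed.

Lemma mdist_lt1 (R : realType) (A : metricType R) (x y : A) :
  (diam [set: A] < 1)%E -> mdist x y < 1.
Proof.
move=> dA; rewrite -lte_fin; apply: le_lt_trans dA.
by apply: ereal_sup_ubound; exists (x, y).
Qed.

(** Indexing the points by an arbitrary type serves two purposes: with ordinals
    as indices it describes moving configurations, and with the points
    themselves as indices it describes a fixed one. *)
Lemma pair_energy_cvg (R : realType) (A : metricType R) (I : eqType)
    (r : seq I) (T : Type) (F : set_system T) (FF : Filter F)
    (sigma : T -> R) (s t : R) (u : T -> I -> A) (v : I -> A) :
  (diam [set: A] < 1)%E -> injective v -> sigma @ F --> s ->
  (forall i, u x i @[x --> F] --> v i) ->
  \sum_(i <- r) \sum_(j <- r | i != j)
      log_riesz_kernel (sigma x) t (mdist (u x i) (u x j)) @[x --> F] -->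
  \sum_(i <- r) \sum_(j <- r | i != j)
      log_riesz_kernel s t (mdist (v i) (v j)).
Proof.
move=> dA vinj sig uv.
apply: cvg_big => [|i _]; first exact: add_continuous.
apply: cvg_big => [|j ij]; first exact: add_continuous.
apply: log_riesz_kernel_cvg => //; last exact: mdist_cvg.
by rewrite mdist_lt1// mdist_gt0 (inj_eq vinj) ij.
Qed.

Lemma energy_enumerates (R : realType) (A : metricType R) (N : nat) (s t : R)
    (x : 'I_N -> A) (w : {fset A}) :
  enumerates x w ->
  energy s t w = \sum_(i <- enum 'I_N) \sum_(j <- enum 'I_N | i != j)
    log_riesz_kernel s t (mdist (x i) (x j)).
Proof.
move=> [xinj ->]; rewrite /energy big_imfset/=; last by move=> i j _ _ /xinj.
apply: eq_bigr => i _.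
rewrite big_mkcond big_imfset/=; last by move=> j k _ _ /xinj.
rewrite [RHS]big_mkcond.
by apply: eq_bigr => j _; rewrite (inj_eq xinj).
Qed.

Theorem theorem2p3 (R : realType) (N : nat) (hN : (2 <= N)%N)
    (t : R) (ht : 0 <= t)
    (A : metricType R)
    (Ainf : infinite_set [set: A]) (Acpt : compact [set: A])
    (Adiam : (diam [set: A] < 1)%E)
    (omega : R -> {fset A})
    (omega_min : forall s : R, 0 <= s -> minimal_configuration N s t (omega s))
    (s0 : R) (hs0 : 0 < s0)
    (w : {fset A}) (hw : cluster_configuration N omega s0 w) :
  minimal_configuration N s0 t w.
Proof.
case: hw => cw [s_ [s_ge0 s_cvg [x_ [x [x_enum x_w x_cvg]]]]].
split=> // w' cw'.
have lim_min : energy (s_ k) t (omega (s_ k)) @[k --> \oo] --> energy s0 t w.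
  rewrite (energy_enumerates _ _ _ _ _ _ _ x_w).
  under eq_fun => k do rewrite (energy_enumerates _ _ _ _ _ _ _ (x_enum k)).
  apply: pair_energy_cvg => //; first by case: x_w.
  move=> i; apply: (cvg_comp x_ (fun g => g i) x_cvg).
  exact: (@proj_continuous _ (fun=> A) i x).
have lim_w' : energy (s_ k) t w' @[k --> \oo] --> energy s0 t w'.
  apply: (@pair_energy_cvg _ _ _ _ _ _ _ s_ _ _ (fun=> id) id) => // i.
  exact: cvg_cst.
apply: (ler_cvg_to lim_min lim_w'); near=> k.
by have [_] := omega_min _ (s_ge0 k); apply.
Unshelve. all: by end_near.
Qed.
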